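(* Let $R$ and $C$ be index sets, let $I\subseteq R\times C$, and let $(x_r)_{r\in R}$ and $(y_c)_{c\in C}$ be families of complex numbers. The relative Schur multiplier on $\mathrm S^\infty_I$ given by $(x_ry_c)_{(r,c)\in I}$ has norm $\sup_{(r,c)\in I}|x_ry_c|$.
   Context: $\mathrm S^\infty$ is the space of compact operators from $\ell^2_C$ to $\ell^2_R$ with the operator norm, operators being identified with their matrices indexed by $R\times C$. $\mathrm S^\infty_I$ is the closed subspace spanned by the elementary matrices $\mathrm e_q$, $q\in I$ (equivalently, the compact operators whose matrix is supported by $I$). The relative Schur multiplier given by $\varrho=(\varrho_q)_{q\in I}$ is the operator on $\mathrm S^\infty_I$ determined by $\mathrm e_q\mapsto\varrho_q\mathrm e_q$ for $q\in I$; its norm (in $[0,\infty]$) is the operator norm, computed on finitely supported matrices. *)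

(* Defs.v *)
From HB Require Import structures.
From mathcomp Require Import all_boot all_order all_algebra.
From mathcomp Require Import all_classical all_reals all_analysis.
From mathcomp Require Import complex.

Set Implicit Arguments.
Unset Strict Implicit.
Unset Printing Implicit Defensive.

Import Order.TTheory GRing.Theory Num.Theory.

Local Open Scope classical_set_scope.
Local Open Scope ring_scope.
Local Open Scope complex_scope.
Local Open Scope ereal_scope.

(* Real-valued modulus of a complex number: [`|z|] itself lives in [K[i]]. *)
Definition cabs (K : realType) (z : K[i]) : K := ComplexField.Normc.normc z.

(* Supremum in [0, +oo], so that the supremum of the empty set is 0 (whereas
   [ereal_sup set0 = -oo]). *)
Definition sup_ge0 (K : realType) (A : set (\bar K)) : \bar K :=
  ereal_sup (0 |` A).

(* The l^2-norm of an arbitrary family, +oo when it is not square-summable. *)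
Definition l2norm (K : realType) (T : choiceType) (f : T -> K[i]) : \bar K :=
  sqrte (\esum_(t in [set: T]) ((cabs (f t)) ^+ 2)%:E).

Definition ell2 (K : realType) (T : choiceType) : set (T -> K[i]) :=
  [set f | l2norm f < +oo].

(* The linear span of the elementary matrices e_q, q in I; it is dense in
   S^oo_I by definition of the latter. *)
Definition fin_supp_in (K : realType) (R C : choiceType) (I : set (R * C)) :
    set (R * C -> K[i]) :=
  [set a | finite_set [set q | a q != 0%R] /\ [set q | a q != 0%R] `<=` I].

(* The sum over c has finite support for every matrix a in [fin_supp_in]; only
   such matrices are ever considered. *)
Definition mx_app (K : realType) (R C : choiceType)
    (a : R * C -> K[i]) (xi : C -> K[i]) : R -> K[i] :=
  fun r => (\sum_(c \in [set: C]) a (r, c) * xi c)%R.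

Definition opnorm (K : realType) (R C : choiceType) (a : R * C -> K[i]) :
    \bar K :=
  ereal_sup [set l2norm (mx_app a xi) | xi in [set xi | ell2 xi /\ l2norm xi <= 1]].

(* The map e_q |-> rho_q e_q; on matrices supported by I it only depends on
   the values of rho on I. *)
Definition schur_mult (K : realType) (R C : choiceType)
    (rho a : R * C -> K[i]) : R * C -> K[i] :=
  fun q => (rho q * a q)%R.

(* Norm, in [0, +oo], of the relative Schur multiplier on S^oo_I given by
   (rho_q)_{q in I}, computed on finitely supported matrices. *)
Definition schur_norm (K : realType) (R C : choiceType) (I : set (R * C))
    (rho : R * C -> K[i]) : \bar K :=
  ereal_sup [set opnorm (schur_mult rho a) |
             a in [set a | fin_supp_in I a /\ opnorm a <= 1]].

(* Main.v *)
Require Import Defs.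
From mathcomp Require Import all_boot all_order all_algebra.
From mathcomp Require Import all_classical all_reals all_analysis.
From mathcomp Require Import complex finmap.
From mathcomp Require Import ring lra.
Import Order.TTheory GRing.Theory Num.Theory.

Local Open Scope classical_set_scope.
Local Open Scope ring_scope.
Local Open Scope complex_scope.

(** The lower bound comes from testing the multiplier on the elementary matrices
    [e_q], which have norm 1.

    For the upper bound, let [M] bound [|x_r y_c|] on the support of a finitely
    supported contraction [a]. If the multiplier can be written there as
    [\sum_j w_j(r) v_j(c)] with [\sum_j |w_j(r)|^2 <= M^2] for every [r] and
    [\sum_j |v_j(c)|^2 <= 1] for every [c], then it has norm at most [M]
    ([opnorm_schur_mult_le]): it sends [a] to
    [\sum_j diag(w_j) a diag(v_j)], and Cauchy-Schwarz in [j] reduces its action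
    on a vector [xi] to that of [a] on the vectors [v_j xi], whose squared norms
    add up to at most that of [xi].

    To factor [x_r y_c], where both numbers are nonzero (the zero entries cause no
    harm), put [p = |y_c|^2] and [q = M^2 / |x_r|^2]. The
    constraint says [p <= q] on the support, so that there
    [x_r y_c = (x_r / conj y_c) min(p, q)]. The point of this rewriting is that
    [min(p, q)] is a Gram kernel: it is the scalar product in [L^2(0, +oo)] of
    the indicators of [[0, p]] and [[0, q]], whose squared norms are [p] and [q].
    Up to phases and the factor [M], this extends the relative multiplier to the
    full positive definite kernel [exp (- |s - t|)], with [s] and [t] the
    logarithms of [|y_c|] and [M / |x_r|].
    As only finitely many values of [p] matter, the integral can be replaced by
    a sum over the subdivision formed by these values ([sum_steps_le],
    [sum_steps_eq]), which gives the factorisation in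
    [opnorm_schur_mult_rank_one]. *)

(** * Moduli and square sums of complex families *)

Section l2sq.
Set Implicit Arguments.
Unset Strict Implicit.
Context {K : realType}.

Lemma cabs_ge0 (z : K[i]) : 0 <= cabs z.
Proof. by case: z => a b; exact: sqrtr_ge0. Qed.

Lemma cabsM (z w : K[i]) : cabs (z * w) = cabs z * cabs w.
Proof. exact: ComplexField.Normc.normcM. Qed.

Lemma cabs0 : cabs (0 : K[i]) = 0.
Proof. exact: ComplexField.Normc.normc0. Qed.

Lemma cabs1 : cabs (1 : K[i]) = 1.
Proof. exact: ComplexField.Normc.normc1. Qed.

Lemma cabsV (z : K[i]) : cabs z^-1 = (cabs z)^-1.
Proof. exact: ComplexField.Normc.normcV. Qed.

Lemma cabs_eq0 (z : K[i]) : cabs z = 0 -> z = 0.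
Proof. exact: ComplexField.Normc.eq0_normc. Qed.

Lemma cabs_real (a : K) : 0 <= a -> cabs a%:C = a.
Proof. by move=> a0; rewrite /cabs /= expr0n /= addr0 sqrtr_sqr ger0_norm. Qed.

Lemma cabs_sum (J : Type) (s : seq J) (f : J -> K[i]) :
  cabs (\sum_(j <- s) f j) <= \sum_(j <- s) cabs (f j).
Proof.
elim/big_ind2 : _ => //[|z a w b za wb]; first by rewrite cabs0.
by rewrite (le_trans (le_normcD _ _))// lerD.
Qed.

(** The defect in the inequality is half of the square sum of the numbers
    [a_i b_j - a_j b_i] (Lagrange's identity). *)
Lemma cauchy_schwarz_sum (J : Type) (s : seq J) (a b : J -> K) :
  (\sum_(j <- s) a j * b j) ^+ 2 <=
  (\sum_(j <- s) a j ^+ 2) * (\sum_(j <- s) b j ^+ 2).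
Proof.
set A := \sum_(j <- s) _ ^+ 2; set B := \sum_(j <- s) b j ^+ 2.
set S := \sum_(j <- s) _.
have lagrange : \sum_(i <- s) \sum_(j <- s) (a i * b j - a j * b i) ^+ 2 =
    2 * (A * B - S ^+ 2).
  transitivity (\sum_(i <- s)
      (a i ^+ 2 * B + b i ^+ 2 * A - 2 * (a i * b i) * S)).
    apply: eq_bigr => i _; rewrite /A /B /S !mulr_sumr -big_split -sumrB /=.
    by apply: eq_bigr => j _; ring.
  rewrite sumrB big_split/= -!mulr_suml -mulr_sumr -/A -/B -/S; ring.
rewrite -subr_ge0 -(pmulr_rge0 _ (ltr0n K 2)) -lagrange.
by apply: sumr_ge0 => i _; apply: sumr_ge0 => j _; exact: sqr_ge0.
Qed.

Lemma cabs_cauchy_schwarz (J : Type) (s : seq J) (z w : J -> K[i]) :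
  cabs (\sum_(j <- s) z j * w j) ^+ 2 <=
  (\sum_(j <- s) cabs (z j) ^+ 2) * (\sum_(j <- s) cabs (w j) ^+ 2).
Proof.
have := cauchy_schwarz_sum s (fun j => cabs (z j)) (fun j => cabs (w j)).
apply: le_trans; rewrite lerXn2r ?nnegrE ?cabs_ge0//.
  by apply: sumr_ge0 => j _; rewrite mulr_ge0 ?cabs_ge0.
by apply: le_trans (cabs_sum _ _) _; under eq_bigr do rewrite cabsM.
Qed.

(** The square of [l2norm]: unlike the norm itself, it is additive over
    decompositions of the family. *)
Definition l2sq (T : choiceType) (f : T -> K[i]) : \bar K :=
  \esum_(t in [set: T]) ((cabs (f t)) ^+ 2)%:E.

Lemma esumZ_le (T : choiceType) (k : K) (f : T -> \bar K) : 0 <= k ->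
  (forall t, 0 <= f t)%E ->
  (\esum_(t in [set: T]) (k%:E * f t) <= k%:E * \esum_(t in [set: T]) f t)%E.
Proof.
move=> k0 f0; apply: ge_ereal_sup => _ [X [finX _] <-].
rewrite -ge0_mule_fsumr//; apply: lee_wpmul2l; first by rewrite lee_fin.
by apply: esum_ge; exists X.
Qed.

Lemma sqrte_le1 (e : \bar K) : (sqrte e <= 1)%E = (e <= 1)%E.
Proof.
have {1}<- : sqrte 1 = 1%E :> \bar K by rewrite /sqrte sqrtr1.
by rewrite lee_sqrt.
Qed.

Lemma l2sq_ge0 (T : choiceType) (f : T -> K[i]) : (0 <= l2sq f)%E.
Proof. by apply: esum_ge0 => t _; rewrite lee_fin sqr_ge0. Qed.

Lemma l2sqZ_le (T : choiceType) (z : K[i]) (f : T -> K[i]) :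
  (l2sq (fun t => z * f t)%R <= (cabs z ^+ 2)%:E * l2sq f)%E.
Proof.
apply: le_trans (esumZ_le _ _); rewrite ?sqr_ge0//; last first.
  by move=> t; rewrite lee_fin sqr_ge0.
by apply: le_esum => t _; rewrite cabsM exprMn EFinM.
Qed.

Lemma l2sq_ge_term (T : choiceType) (f : T -> K[i]) (t : T) :
  ((cabs (f t) ^+ 2)%:E <= l2sq f)%E.
Proof.
apply: esum_ge; exists [set t]; last by rewrite fsbig_set1.
by split; [exact: finite_set1|].
Qed.

Lemma l2sq_single (T : choiceType) (f : T -> K[i]) (t : T) :
  (forall s, s != t -> f s = 0) -> l2sq f = (cabs (f t) ^+ 2)%:E.
Proof.
move=> f0; rewrite -(@esum_set1 _ _ t (fun s => (cabs (f s) ^+ 2)%:E)); last first.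
  by rewrite lee_fin sqr_ge0.
rewrite [RHS]esum_mkcond; apply: eq_esum => s _.
rewrite in_set1; case: eqVneq => // /f0 ->.
by rewrite cabs0 expr0n.
Qed.

Lemma l2norm_single (T : choiceType) (f : T -> K[i]) (t : T) :
  (forall s, s != t -> f s = 0) -> l2norm f = (cabs (f t))%:E.
Proof.
move=> /l2sq_single f1; rewrite /l2norm -/(l2sq f) f1 /=.
by rewrite sqrtr_sqr ger0_norm ?cabs_ge0.
Qed.

Lemma l2norm_le1 (T : choiceType) (f : T -> K[i]) :
  (l2norm f <= 1)%E = (l2sq f <= 1)%E.
Proof. exact: sqrte_le1. Qed.

Lemma ell2_l2norm_le1 (T : choiceType) (f : T -> K[i]) :
  (l2norm f <= 1)%E -> ell2 f.
Proof. by move=> f1; rewrite /ell2 /= (le_lt_trans f1)// ltry. Qed.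
End l2sq.

(** * Matrices acting on square-summable families *)

Section operators.
Set Implicit Arguments.
Unset Strict Implicit.
Context {K : realType} {R C : choiceType}.
Implicit Types (a : R * C -> K[i]) (xi : C -> K[i]).

Lemma mx_appZ a (z : K[i]) xi (r : R) :
  mx_app a (fun c => z * xi c) r = z * mx_app a xi r.
Proof. by rewrite /mx_app mulr_fsumr; apply: eq_fsbigr => c _; rewrite mulrCA. Qed.

Lemma mx_app0 a : mx_app a (fun=> 0) = (fun=> 0).
Proof.
by apply/funext => r; rewrite /mx_app fsbig1// => c _; rewrite mulr0.
Qed.

Lemma opnorm_ub a xi : (l2norm xi <= 1)%E -> (l2norm (mx_app a xi) <= opnorm a)%E.
Proof.
move=> xi1; apply: ereal_sup_ubound; exists xi => //; split => //.
exact: ell2_l2norm_le1.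
Qed.

Lemma opnorm_ge0 a : (0 <= opnorm a)%E.
Proof.
apply: le_trans (@opnorm_ub a (fun=> 0) _); first exact: sqrte_ge0.
by rewrite l2norm_le1 /l2sq esum1// => c _; rewrite cabs0 expr0n.
Qed.

(** Homogeneity extends the bound from the unit ball to all families. Those of
    square sum [0] cannot be normalised, but they vanish identically. *)
Lemma contraction_l2sq a xi :
  (opnorm a <= 1)%E -> (l2sq (mx_app a xi) <= l2sq xi)%E.
Proof.
move=> a1; case E : (l2sq xi) => [s||]; last first.
- by have := l2sq_ge0 xi; rewrite E.
- by rewrite leey.
have s0 : 0 <= s by rewrite -lee_fin -E l2sq_ge0.
have [s_eq0|s_neq0] := eqVneq s 0.
  suff -> : xi = (fun=> 0).
    rewrite mx_app0 /l2sq esum1 ?lee_fin// => r _.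
    by rewrite cabs0 expr0n.
  apply/funext => c; apply: cabs_eq0; apply/eqP; rewrite -sqrf_eq0 eq_le sqr_ge0.
  by rewrite andbT -lee_fin; apply: le_trans (l2sq_ge_term xi c) _; rewrite E s_eq0.
have sp : 0 < s by rewrite lt_neqAle eq_sym s_neq0.
pose u : K[i] := (Num.sqrt s)%:C.
have cabs_u : cabs u ^+ 2 = s by rewrite cabs_real ?sqrtr_ge0// sqr_sqrtr.
have u0 : u != 0.
  by apply: contraTneq sp => u0; rewrite -cabs_u u0 cabs0 expr0n ltxx.
pose xi' c := u^-1 * xi c.
have xi'1 : (l2norm xi' <= 1)%E.
  rewrite l2norm_le1; apply: le_trans (l2sqZ_le _ _) _.
  by rewrite cabsV exprVn cabs_u E -EFinM mulVf.
have -> : mx_app a xi = fun r => u * mx_app a xi' r.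
  apply/funext => r; rewrite -mx_appZ; congr (mx_app a _ r).
  by apply/funext => c; rewrite /xi' mulVKf.
apply: le_trans (l2sqZ_le _ _) _.
rewrite cabs_u -[leRHS]mule1; apply: lee_wpmul2l; first by rewrite lee_fin.
by rewrite -l2norm_le1; apply: le_trans (@opnorm_ub _ _ xi'1) a1.
Qed.

(** The sufficient condition for Schur multipliers: with
    [f_j = a (v_j xi)], the multiplied matrix sends [xi] to [\sum_j w_j f_j],
    whose square sum is at most [M^2 \sum_j |f_j|^2] by Cauchy-Schwarz in [j];
    since [a] is a contraction, the square sums of the [f_j] are dominated by
    those of the [v_j xi]. The factorisation of [rho] is only required on the
    support of [a], which is what makes the criterion fit for relative
    multipliers. *)
Lemma opnorm_schur_mult_le a (rho : R * C -> K[i]) (M : K)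
    (J : choiceType) (s : seq J) (w : J -> R -> K[i]) (v : J -> C -> K[i]) :
  0 <= M -> finite_set [set q | a q != 0] ->
  (forall q, a q != 0 -> rho q = \sum_(j <- s) w j q.1 * v j q.2) ->
  (forall r, \sum_(j <- s) cabs (w j r) ^+ 2 <= M ^+ 2) ->
  (forall c, \sum_(j <- s) cabs (v j c) ^+ 2 <= 1) ->
  (opnorm a <= 1)%E -> (opnorm (schur_mult rho a) <= M%:E)%E.
Proof.
move=> M0 afin rhoE wM v1 a1.
apply: ge_ereal_sup => _ [xi [_ xi1] <-].
pose f j := mx_app a (fun c => v j c * xi c).
have appE r : mx_app (schur_mult rho a) xi r = \sum_(j <- s) w j r * f j r.
  pose S : {fset C} := fset_set [set q.2 | q in [set q | a q != 0]].
  (* finiteness of the support is needed to exchange the sums over j and c *)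
  have aS r' c : c \notin S -> a (r', c) = 0.
    rewrite in_fset_set; last exact: finite_image.
    by move/negP => h; apply/eqP/negPn/negP => arc; apply: h; apply/mem_set; exists (r', c).
  have sumS (g : C -> K[i]) : (forall c, c \notin S -> g c = 0) ->
      \sum_(c \in [set: C]) g c = \sum_(c <- S) g c.
    move=> g0; rewrite (fsbigTE S)// => c; exact: g0.
  rewrite /f /mx_app sumS; last by move=> c /aS; rewrite /schur_mult => ->; rewrite mulr0 mul0r.
  under [RHS]eq_bigr => j _.
    rewrite sumS; last by move=> c /aS ->; rewrite mul0r.
    rewrite mulr_sumr; over.
  rewrite exchange_big /=; apply: eq_bigr => c _; rewrite /schur_mult.
  have [->|/rhoE ->] := eqVneq (a (r, c)) 0.
    by rewrite mulr0 mul0r big1// => j _; rewrite mul0r mulr0.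
  rewrite /= !mulr_suml; apply: eq_bigr => j _; ring.
have : (l2sq (mx_app (schur_mult rho a) xi) <= (M ^+ 2)%:E)%E.
  apply: (@le_trans _ _ ((M ^+ 2)%:E *
      \esum_(r in [set: R]) \sum_(j <- s) (cabs (f j r) ^+ 2)%:E)%E).
    apply: le_trans (esumZ_le _ _); rewrite ?sqr_ge0//; last first.
      by move=> r; apply: sume_ge0 => j _; rewrite lee_fin sqr_ge0.
    apply: le_esum => r _; rewrite sumEFin -EFinM lee_fin appE.
    apply: le_trans (cabs_cauchy_schwarz _ _ _) _.
    by rewrite ler_wpM2r// sumr_ge0// => j _; rewrite sqr_ge0.
  rewrite -[leRHS]mule1; apply: lee_wpmul2l; first by rewrite lee_fin sqr_ge0.
  rewrite esum_sum; last by move=> *; rewrite lee_fin sqr_ge0.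
  apply: (@le_trans _ _ (\sum_(j <- s) l2sq (fun c => v j c * xi c)%R)%E).
    by apply: lee_sum => j _; exact: contraction_l2sq.
  rewrite -esum_sum; last by move=> *; rewrite lee_fin sqr_ge0.
  apply: (@le_trans _ _ (l2sq xi)); last by rewrite -l2norm_le1.
  apply: le_esum => c _; rewrite sumEFin lee_fin.
  under eq_bigr do rewrite cabsM exprMn.
  by rewrite -mulr_suml ler_piMl ?sqr_ge0.
rewrite -lee_sqrt; last by rewrite lee_fin sqr_ge0.
by rewrite [X in (_ <= X)%E]/= sqrtr_sqr ger0_norm.
Qed.
End operators.

(** * Subdivisions of an interval *)

Section staircase.
Set Implicit Arguments.
Unset Strict Implicit.
Context {K : realType}.

(** The intervals of a subdivision [t0 <= t1 <= ...], each given by its length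
    and its right endpoint: summing the lengths of those with right endpoint in
    an initial segment is a discrete form of integrating its indicator. *)
Definition steps (t0 : K) (s : seq K) : seq (K * K) :=
  pairmap (fun t t' => (t' - t, t')) t0 s.

Lemma steps_ge0 (t0 : K) (s : seq K) :
  path <=%R t0 s -> forall j, j \in steps t0 s -> 0 <= j.1.
Proof.
elim: s t0 => //= t s IH t0 /andP[t0t ps] j; rewrite inE => /predU1P[->/=|].
  by rewrite subr_ge0.
exact: IH.
Qed.

Lemma le_steps (t0 : K) (s : seq K) :
  path <=%R t0 s -> forall j, j \in steps t0 s -> t0 <= j.2.
Proof.
elim: s t0 => //= t s IH t0 /andP[t0t ps] j; rewrite inE => /predU1P[->//|js].
exact: le_trans t0t (IH _ ps _ js).
Qed.

(** The intervals with right endpoint in the initial segment [P] come first and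
    their lengths telescope, so that [t0] plus their sum is the last point of
    the subdivision in [P], or [t0]. The bound [b * t <= m] on [P] plays the role
    of [t <= m / b] in a form that makes sense for [b = 0]. *)
Lemma sum_steps_le (P : pred K) (b m t0 : K) (s : seq K) :
  (forall t, t \in s -> P t -> b * t <= m) ->
  (forall t t', t <= t' -> P t' -> P t) ->
  path <=%R t0 s -> b * t0 <= m ->
  b * (t0 + \sum_(j <- steps t0 s | P j.2) j.1) <= m.
Proof.
move=> Pm Pdown; elim: s t0 Pm => [|t s IH] t0 Pm /=.
  by rewrite big_nil addr0.
move=> /andP[t0t ps] t0m; rewrite big_cons /=; case: ifPn => Pt.
  rewrite addrA [t0 + _]addrC subrK; apply: IH => //.
    by move=> u us; apply: Pm; rewrite inE us orbT.
  by apply: Pm => //; rewrite mem_head.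
rewrite big1_seq ?addr0//= => j /andP[Pj js].
by move: Pt; rewrite (Pdown _ j.2)//; exact: le_steps js.
Qed.

(** When [p] itself is a point of the subdivision, the telescoping sum of the
    intervals that end at or before [p] is exact. *)
Lemma sum_steps_eq (p t0 : K) (s : seq K) :
  path <=%R t0 s -> p \in t0 :: s ->
  t0 + \sum_(j <- steps t0 s | j.2 <= p) j.1 = p.
Proof.
elim: s t0 => [|t s IH] t0 /=; first by rewrite mem_seq1 big_nil addr0 => _ /eqP.
move=> /andP[t0t ps] pin; rewrite big_cons /=; case: ifPn => tp.
  rewrite addrA [t0 + _]addrC subrK; apply: IH => //.
  move: pin; rewrite inE => /predU1P[pt0|//]; rewrite inE; apply/orP; left.
  by rewrite eq_le tp andbT pt0.
have t_le j : j \in steps t s -> (j.2 <= p) = false.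
  by move=> /(le_steps ps) tj; apply: contraNF tp; exact: le_trans.
rewrite big1_seq ?addr0 => [|j /andP[jp /t_le]]; last by rewrite jp.
move: pin; rewrite inE => /predU1P[//|pts].
have /allP/(_ _ pts) : all (>= t) (t :: s).
  by rewrite /= lexx; apply: order_path_min ps; exact: le_trans.
by rewrite /= (negPf tp).
Qed.
End staircase.

(** * Multipliers of rank one *)

Section rank_one.
Set Implicit Arguments.
Unset Strict Implicit.
Context {K : realType} {R C : choiceType}.

(** The factors are [w_j(r) = x_r sqrt(d_j)] when [t_j |x_r|^2 <= M^2], and
    [v_j(c) = sqrt(d_j) y_c / |y_c|^2] when [t_j <= |y_c|^2], both being [0]
    otherwise, where [(d_j, t_j)] runs through the intervals of the subdivision
    of [[0, +oo[] by the values [|y_c|^2] for [c] a column of the support. At an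
    entry of the support, [t_j <= |y_c|^2] implies [t_j |x_r|^2 <= M^2], so the
    product is cut off by the former condition alone and the [d_j] add up to
    [|y_c|^2], leaving [x_r y_c]. *)
Lemma opnorm_schur_mult_rank_one (x : R -> K[i]) (y : C -> K[i])
    (a : R * C -> K[i]) (M : K) :
  0 <= M -> finite_set [set q | a q != 0] ->
  (forall q, a q != 0 -> cabs (x q.1 * y q.2) <= M) ->
  (opnorm a <= 1)%E ->
  (opnorm (schur_mult (fun q => x q.1 * y q.2)%R a) <= M%:E)%E.
Proof.
move=> M0 afin xyM a1.
pose p c := cabs (y c) ^+ 2.
pose S : {fset C} := fset_set [set q.2 | q in [set q | a q != 0]].
pose T := sort <=%R [seq p c | c <- S].
have p0 c : 0 <= p c by exact: sqr_ge0.
have pathT : path <=%R 0 T.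
  rewrite path_sortedE; last exact: le_trans.
  rewrite sort_le_sorted andbT; apply/allP => t.
  by rewrite mem_sort => /mapP[c _ ->].
have T0 t : t \in T -> 0 <= t by rewrite mem_sort => /mapP[c _ ->].
pose s := steps 0 T.
have s0 j : j \in s -> 0 <= j.1 by exact: steps_ge0.
pose w (j : K * K) r : K[i] :=
  if j.2 * cabs (x r) ^+ 2 <= M ^+ 2 then (Num.sqrt j.1)%:C * x r else 0.
pose v (j : K * K) c : K[i] :=
  if j.2 <= p c then (Num.sqrt j.1)%:C * (y c / (p c)%:C) else 0.
have sqr_sqrtC j (z : K[i]) : j \in s ->
    cabs ((Num.sqrt j.1)%:C * z) ^+ 2 = cabs z ^+ 2 * j.1.
  by move=> js; rewrite cabsM exprMn cabs_real ?sqrtr_ge0// sqr_sqrtr ?s0// mulrC.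
apply: (opnorm_schur_mult_le (s := s) (w := w) (v := v)) => //.
- move=> [r c] arc /=.
  have pT : p c \in 0 :: T.
    rewrite inE mem_sort; apply/orP; right; apply: map_f.
    rewrite in_fset_set; last exact: finite_image.
    by apply/mem_set; exists (r, c).
  rewrite (eq_big_seq (fun j : K * K =>
    if j.2 <= p c then (j.1)%:C * (x r * (y c / (p c)%:C)) else 0)); last first.
    move=> j js; rewrite /w /v; case: (leP j.2 (p c)) => [jp|_]; last by rewrite mulr0.
    rewrite ifT.
      rewrite -[in RHS](sqr_sqrtr (s0 _ js)) expr2 rmorphM /=; ring.
    apply: (@le_trans _ _ (p c * cabs (x r) ^+ 2)).
      by rewrite ler_wpM2r// sqr_ge0.
    rewrite /p -exprMn mulrC -cabsM lerXn2r ?nnegrE ?cabs_ge0//.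
    by have := xyM _ arc; rewrite mulrC.
  rewrite -big_mkcond /= -mulr_suml -rmorph_sum /= -[\sum_(_ <- _ | _) _]add0r.
  rewrite sum_steps_eq//.
  (* if y c = 0, both sides vanish, as 0^-1 = 0 *)
  have [y0|y0] := eqVneq (y c) 0; first by rewrite y0 mul0r !mulr0.
  have pc0 : (p c)%:C != 0.
    apply: contra y0 => /eqP/complexI/eqP; rewrite sqrf_eq0 => /eqP.
    by move=> /cabs_eq0 ->.
  by field.
- move=> r; rewrite (eq_big_seq (fun j : K * K =>
    if j.2 * cabs (x r) ^+ 2 <= M ^+ 2 then cabs (x r) ^+ 2 * j.1 else 0)); last first.
    move=> j js; rewrite /w; case: ifPn => _; first exact: sqr_sqrtC.
    by rewrite cabs0 expr0n.
  rewrite -big_mkcond /= -mulr_sumr -[\sum_(_ <- _ | _) _]add0r.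
  apply: (sum_steps_le (P := fun t => t * cabs (x r) ^+ 2 <= M ^+ 2)) => //.
  + by move=> t _; rewrite mulrC.
  + by move=> t t' tt'; apply: le_trans; rewrite ler_wpM2r// sqr_ge0.
  + by rewrite mulr0 sqr_ge0.
- move=> c; rewrite (eq_big_seq (fun j : K * K =>
    if j.2 <= p c then cabs (y c / (p c)%:C) ^+ 2 * j.1 else 0)); last first.
    move=> j js; rewrite /v; case: ifPn => _; first exact: sqr_sqrtC.
    by rewrite cabs0 expr0n.
  rewrite -big_mkcond /= -mulr_sumr.
  have sum_le : \sum_(j <- s | j.2 <= p c) j.1 <= p c.
    rewrite -[leLHS]add0r -[leLHS]mul1r.
    apply: (sum_steps_le (P := fun t => t <= p c)) => //.
    + by move=> t _; rewrite mul1r.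
    + by move=> t t'; exact: le_trans.
    + by rewrite mulr0.
  have [pc0|pc0] := eqVneq (p c) 0.
    by rewrite pc0 invr0 mulr0 cabs0 expr0n mul0r.
  apply: (@le_trans _ _ (cabs (y c / (p c)%:C) ^+ 2 * p c)).
    by rewrite ler_wpM2l// sqr_ge0.
  rewrite cabsM cabsV cabs_real// exprMn -/(p c) exprVn.
  by rewrite [leLHS](_ : _ = 1)//; field.
Qed.

(** The zero matrix belongs to every unit ball, so the supremum defining the norm
    is nonnegative even when [I] is empty. *)
Lemma schur_norm_ge0 (I : set (R * C)) (rho : R * C -> K[i]) :
  (0 <= schur_norm I rho)%E.
Proof.
apply: (@le_trans _ _ (opnorm (schur_mult rho (fun=> 0)))).
  exact: opnorm_ge0.
apply: ereal_sup_ubound; exists (fun=> 0) => //; split.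
  by split; [rewrite [X in finite_set X](_ : _ = set0)//|];
    rewrite -?subset0 => q /=; rewrite eqxx.
apply: ge_ereal_sup => _ [xi _ <-]; rewrite l2norm_le1 /l2sq esum1 ?lee01// => r _.
by rewrite /mx_app fsbig1 ?cabs0 ?expr0n// => c _; rewrite mul0r.
Qed.

(** The elementary matrix [e_q] is a contraction, and its multiple by [rho_q]
    attains the norm [|rho_q|] at a basis vector. *)
Lemma schur_norm_ge (I : set (R * C)) (rho : R * C -> K[i]) (q : R * C) :
  I q -> ((cabs (rho q))%:E <= schur_norm I rho)%E.
Proof.
case: q => r0 c0 Iq.
pose e (q : R * C) : K[i] := if q == (r0, c0) then 1 else 0.
have appE (z : R * C -> K[i]) (xi : C -> K[i]) r : mx_app (schur_mult z e) xi r =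
    if r == r0 then z (r0, c0) * xi c0 else 0.
  rewrite /mx_app (fsbigTE [fset c0]%fset); last first.
    move=> c; rewrite inE => cc0; rewrite /schur_mult /e xpair_eqE (negPf cc0).
    by rewrite andbF mulr0 mul0r.
  rewrite big_seq_fset1 /schur_mult /e xpair_eqE eqxx andbT.
  by case: eqVneq => [->|_]; rewrite ?mulr1// mulr0 mul0r.
have l2E (z : R * C -> K[i]) (xi : C -> K[i]) :
    l2norm (mx_app (schur_mult z e) xi) = (cabs (z (r0, c0) * xi c0))%:E.
  rewrite (@l2norm_single _ _ _ r0) ?appE ?eqxx// => r rr0.
  by rewrite appE (negPf rr0).
apply: (@le_trans _ _ (opnorm (schur_mult rho e))).
  pose d (c : C) : K[i] := if c == c0 then 1 else 0.
  have d1 : (l2norm d <= 1)%E.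
    rewrite (@l2norm_single _ _ _ c0) /d ?eqxx ?cabs1// => c /negPf -> //.
  by have := opnorm_ub (schur_mult rho e) d1; rewrite l2E /d eqxx mulr1.
apply: ereal_sup_ubound; exists e => //; split.
  have sub : [set q | e q != 0] `<=` [set (r0, c0)].
    by move=> q; rewrite /e /=; case: (eqVneq q (r0, c0)) => // _; rewrite eqxx.
  by split; [exact: sub_finite_set sub (finite_set1 _)|move=> q /sub ->].
apply: ge_ereal_sup => _ [xi [_ xi1] <-].
have -> : e = schur_mult (fun=> 1) e by apply/funext => q; rewrite /schur_mult mul1r.
rewrite l2E mul1r lee_fin -(@expr_le1 _ 2) ?cabs_ge0// -lee_fin.
by apply: le_trans (l2sq_ge_term xi c0) _; rewrite -l2norm_le1.
Qed.
End rank_one.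

Theorem theorem1p7 (K : realType) (R C : choiceType) (I : set (R * C))
    (x : R -> K[i]) (y : C -> K[i]) :
  schur_norm I (fun q => x q.1 * y q.2) =
  sup_ge0 [set (cabs (x q.1 * y q.2))%:E | q in I].
Proof.
apply/eqP; rewrite eq_le; apply/andP; split; last first.
  apply: ge_ereal_sup => _ [->|[q Iq <-]]; first exact: schur_norm_ge0.
  exact: (schur_norm_ge (fun q => x q.1 * y q.2)).
set m := sup_ge0 _.
have m_ge q : I q -> ((cabs (x q.1 * y q.2))%:E <= m)%E.
  by move=> Iq; apply: ereal_sup_ubound; right; exists q.
have m0 : (0 <= m)%E by apply: ereal_sup_ubound; left.
apply: ge_ereal_sup => _ [a [[afin aI] a1] <-].
case: m m0 m_ge => [M||//] m0 m_ge; last by rewrite leey.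
apply: opnorm_schur_mult_rank_one => //.
by move=> q /aI/m_ge; rewrite lee_fin.
Qed.
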